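(* Let $A\in\mathcal{V}$ and $\theta\in Con(A)$. Then $\theta$ has $CBLP$ if and only if $\rho(\theta)$ has $CBLP$.
   Context: $\mathcal{V}$ is a congruence modular, semidegenerate variety (no nontrivial algebra has a one-element subalgebra; equivalently $\nabla_B$ is compact for all $B\in\mathcal{V}$) of finite signature. For $B\in\mathcal{V}$: $Con(B)$ is its congruence lattice with bounds $\Delta_B,\nabla_B$, $[\cdot,\cdot]$ the Freese–McKenzie commutator, $K(B)$ the compact congruences. A congruence $\phi\neq\nabla_B$ is prime if $[\alpha,\beta]\subseteq\phi$ implies $\alpha\subseteq\phi$ or $\beta\subseteq\phi$; $\rho(\theta)$ is the intersection of all prime congruences containing $\theta$. $B(Con(B))$ is the Boolean algebra of complemented elements of $Con(B)$. When $K(B)$ is closed under the commutator, the reticulation $L(B)=K(B)/{\equiv}$ ($\alpha\equiv\beta$ iff $\rho(\alpha)=\rho(\beta)$) is a bounded distributive lattice with canonical map $\lambda_B$, which maps $B(Con(B))$ injectively into the Boolean center $B(L(B))$; the reticulation of $B$ preserves the Boolean center if this map $B(Con(B))\to B(L(B))$ is surjective. Standing assumption: for every $B\in\mathcal{V}$, $K(B)$ is closed under the commutator and the reticulation of $B$ preserves the Boolean center. For $\theta\in Con(A)$, congruences of $A/\theta$ are exactly $\chi/\theta$ with $\chi\supseteq\theta$. The congruence $\theta$ has the Congruence Boolean Lifting Property ($CBLP$) if for every $\beta\in B(Con(A/\theta))$ there exists $\alpha\in B(Con(A))$ with $(\alpha\vee\theta)/\theta=\beta$. *)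

(* Defs.v *)
From Stdlib Require Import ClassicalEpsilon.
From mathcomp Require Import all_boot.

Set Implicit Arguments.
Unset Strict Implicit.
Unset Printing Implicit Defensive.

Record signature := Signature { sym : finType; arity : sym -> nat }.

Record algebra (S : signature) := Algebra {
  carrier :> Type;
  op : forall f : sym S, ('I_(arity f) -> carrier) -> carrier }.
Arguments op {S} _ f _.

Inductive term (S : signature) (X : Type) : Type :=
| Var : X -> term S X
| App : forall f : sym S, ('I_(arity f) -> term S X) -> term S X.
Arguments Var {S X} _.
Arguments App {S X} f _.

Fixpoint eval (S : signature) (A : algebra S) (X : Type) (v : X -> A)
  (t : term S X) : A :=
  match t with
  | Var x => v x
  | App f ts => op A f (fun i => eval v (ts i))
  end.

(* The variety V is the class of models of a set Sigma of identities. *)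
Definition models (S : signature) (Sigma : term S nat * term S nat -> Prop)
  (A : algebra S) : Prop :=
  forall e, Sigma e -> forall v : nat -> A, eval v e.1 = eval v e.2.

Definition prel (T : Type) := T -> T -> Prop.
Definition subrel (T : Type) (r s : prel T) := forall x y, r x y -> s x y.
Definition releq (T : Type) (r s : prel T) := forall x y, r x y <-> s x y.

Definition is_con (S : signature) (A : algebra S) (th : prel A) : Prop :=
  (forall x, th x x) /\ (forall x y, th x y -> th y x) /\
  (forall x y z, th x y -> th y z -> th x z) /\
  (forall (f : sym S) (a b : 'I_(arity f) -> A),
      (forall i, th (a i) (b i)) -> th (op A f a) (op A f b)).

Definition Delta (T : Type) : prel T := fun x y => x = y.
Definition Nabla (T : Type) : prel T := fun _ _ => True.
Definition meet (T : Type) (a b : prel T) : prel T := fun x y => a x y /\ b x y.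

Definition Cg (S : signature) (A : algebra S) (R : prel A) : prel A :=
  fun x y => forall g : prel A, is_con g -> subrel R g -> g x y.
Definition join (S : signature) (A : algebra S) (a b : prel A) : prel A :=
  Cg (fun x y => a x y \/ b x y).
Definition bigjoin (S : signature) (A : algebra S) (I : Type)
  (F : I -> prel A) : prel A := Cg (fun x y => exists i, F i x y).

Definition compact (S : signature) (A : algebra S) (a : prel A) : Prop :=
  is_con a /\
  forall (I : Type) (F : I -> prel A), (forall i, is_con (F i)) ->
    subrel a (bigjoin F) ->
    exists s : list I,
      subrel a (Cg (fun x y => exists i, List.In i s /\ F i x y)).

Definition sv (T : Type) (a c : nat -> T) : nat + nat -> T :=
  fun z => match z with inl i => a i | inr j => c j end.

(* the centrality (term) condition C(a,b;d) of Freese--McKenzie *)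
Definition centralizes (S : signature) (A : algebra S) (a b d : prel A) : Prop :=
  forall (t : term S (nat + nat)) (x y u w : nat -> A),
    (forall i, a (x i) (y i)) -> (forall j, b (u j) (w j)) ->
    d (eval (sv x u) t) (eval (sv x w) t) ->
    d (eval (sv y u) t) (eval (sv y w) t).

Definition comm (S : signature) (A : algebra S) (a b : prel A) : prel A :=
  fun x y => forall d : prel A, is_con d -> centralizes a b d -> d x y.

Definition prime_con (S : signature) (A : algebra S) (phi : prel A) : Prop :=
  is_con phi /\ ~ releq phi (@Nabla A) /\
  forall a b : prel A, is_con a -> is_con b ->
    subrel (comm a b) phi -> subrel a phi \/ subrel b phi.

Definition rho (S : signature) (A : algebra S) (th : prel A) : prel A :=
  fun x y => forall phi : prel A, prime_con phi -> subrel th phi -> phi x y.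

Definition complemented (S : signature) (A : algebra S) (a : prel A) : Prop :=
  is_con a /\ exists b : prel A, is_con b /\
    releq (meet a b) (@Delta A) /\ releq (join a b) (@Nabla A).

Definition con_modular (S : signature) (A : algebra S) : Prop :=
  forall a b g : prel A, is_con a -> is_con b -> is_con g -> subrel a g ->
    subrel (meet (join a b) g) (join a (meet b g)).

Definition semidegenerate_alg (S : signature) (A : algebra S) : Prop :=
  (exists x y : A, x <> y) ->
  ~ (exists e : A, forall f : sym S, op A f (fun _ => e) = e).

Definition K_comm_closed (S : signature) (A : algebra S) : Prop :=
  forall a b : prel A, compact a -> compact b -> compact (comm a b).

(* The reticulation L(A) = K(A)/== with a == b iff rho a = rho b, with
   lambda(a) /\ lambda(b) = lambda([a,b]), lambda(a) \/ lambda(b) =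
   lambda(a \/ b), 0 = lambda(Delta), 1 = lambda(Nabla).
   "The reticulation preserves the Boolean center": every complemented
   element lambda(a) of L(A) is lambda(g) for some g in B(Con(A)).
   (Complementation in L(A) unfolded through these operations.) *)
Definition ret_preserves_BC (S : signature) (A : algebra S) : Prop :=
  forall a : prel A, compact a ->
    (exists b : prel A, compact b /\
       releq (rho (comm a b)) (rho (@Delta A)) /\
       releq (rho (join a b)) (rho (@Nabla A))) ->
    exists g : prel A, complemented g /\ releq (rho g) (rho a).

Section Quotient.
Variables (S : signature) (A : algebra S) (th : prel A).

Definition qcarrier : Type := {P : A -> Prop | exists a, P = th a}.
Definition qclass (a : A) : qcarrier := exist _ (th a) (ex_intro _ a erefl).
Definition qrep (X : qcarrier) : A :=
  proj1_sig (constructive_indefinite_description _ (proj2_sig X)).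

Definition quot_alg : algebra S :=
  @Algebra S qcarrier (fun f xs => qclass (op A f (fun i => qrep (xs i)))).

(* chi / theta, for chi containing theta *)
Definition quot_rel (chi : prel A) : prel quot_alg :=
  fun X Y => chi (qrep X) (qrep Y).
End Quotient.

Definition CBLP (S : signature) (A : algebra S) (th : prel A) : Prop :=
  forall b : prel (quot_alg th), complemented b ->
    exists a : prel A, complemented a /\ releq (@quot_rel S A th (join a th)) b.

(* Main.v *)
(** For a congruence [b], centrality [C(a, b; d)] says that some congruence of
    the subalgebra [b] of [A * A] identifies the diagonal elements along [a] and
    keeps [{(x, y) | d x y}] saturated.  The modular law of [Con(b)], in the form
    of the shifting lemma, then makes [C(a, b; d)] increasing in [d] and symmetric
    in [a] and [b], and semidegeneracy makes [C(Nabla, m; d)] equivalent to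
    [m <= d].  Since the signature is finite, [Nabla] is finitely generated, so
    every proper congruence lies below a prime one.

    It follows that [e |-> e \/ rho th] is a bijection from the complemented
    elements of the interval [[th, Nabla]] to those of [[rho th, Nabla]]: it is
    injective because complemented elements are determined by the primes above
    them, and surjective because the reticulation of [A / th] preserves the
    Boolean center.  As [a \/ th \/ rho th = a \/ rho th], the complemented
    congruences of [A] reach all of the first set iff they reach all of the
    second. *)

From Stdlib Require Import ClassicalEpsilon FunctionalExtensionality.
From Stdlib Require Import PropExtensionality ProofIrrelevance.
From mathcomp Require Import all_boot.
From mathcomp Require classical_sets.
Require Import Defs.

Set Implicit Arguments.
Unset Strict Implicit.
Unset Printing Implicit Defensive.

(** * Congruences *)

Lemma prel_ext (T : Type) (r s : prel T) : releq r s -> r = s.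
Proof.
move=> rs; apply: functional_extensionality => x.
by apply: functional_extensionality => y; apply: propositional_extensionality.
Qed.

Lemma skolem (I T : Type) (P : I -> T -> Prop) :
  (forall i, exists x, P i x) -> exists f, forall i, P i (f i).
Proof.
move=> ex; exists (fun i => proj1_sig (constructive_indefinite_description _ (ex i))).
by move=> i; case: constructive_indefinite_description.
Qed.

Section Congruences.
Variables (S : signature) (A : algebra S).
Implicit Types a b d g : prel A.

Lemma con_refl g : is_con g -> forall x, g x x.
Proof. by case. Qed.

Lemma con_sym g : is_con g -> forall x y, g x y -> g y x.
Proof. by case=> _ []. Qed.

Lemma con_trans g : is_con g -> forall y x z, g x y -> g y z -> g x z.
Proof. by case=> _ [_ [tr _]] y x z; apply: tr. Qed.

Lemma con_op g : is_con g -> forall (f : sym S) (a b : 'I_(arity f) -> A),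
  (forall i, g (a i) (b i)) -> g (op A f a) (op A f b).
Proof. by case=> _ [_ [_]]. Qed.

Lemma con_eval g (X : Type) (v w : X -> A) (t : term S X) :
  is_con g -> (forall x, g (v x) (w x)) -> g (eval v t) (eval w t).
Proof. by move=> cg vw; elim: t => //= f ts IH; apply: con_op. Qed.

Lemma con_Delta : is_con (@Delta A).
Proof.
split=> //; split; first by move=> x y ->.
split; first by move=> x y z -> ->.
by move=> f a b ab; congr op; apply: functional_extensionality.
Qed.

Lemma con_Nabla : is_con (@Nabla A).
Proof. by []. Qed.

Lemma con_meet a b : is_con a -> is_con b -> is_con (meet a b).
Proof.
move=> ca cb; split; first by move=> x; split; apply: con_refl.
split; first by move=> x y [? ?]; split; apply: con_sym.
split; last by move=> f u v uv; split; apply: con_op => // i; case: (uv i).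
by move=> x y z [? ?] [? ?]; split; apply: (@con_trans _ _ y).
Qed.

Lemma con_forall (P : prel A -> Prop) :
  (forall g, P g -> is_con g) -> is_con (fun x y => forall g, P g -> g x y).
Proof.
move=> cP; split; first by move=> x g /cP/con_refl.
split; first by move=> x y xy g Pg; apply: (con_sym (cP _ Pg)); apply: xy.
split; last by move=> f u v uv g Pg; apply: (con_op (cP _ Pg)) => i; apply: uv.
by move=> x y z xy yz g Pg; apply: (con_trans (cP _ Pg) (xy _ Pg)); apply: yz.
Qed.

Lemma con_Cg (R : prel A) : is_con (Cg R).
Proof.
have -> : Cg R = fun x y => forall g, is_con g /\ subrel R g -> g x y.
  by apply: prel_ext => x y; split=> [xy g []|xy g cg Rg]; apply: xy.
by apply: con_forall => g [].
Qed.

Lemma sub_Cg (R : prel A) : subrel R (Cg R).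
Proof. by move=> x y Rxy g _; apply. Qed.

Lemma Cg_sub (R : prel A) g : is_con g -> subrel R g -> subrel (Cg R) g.
Proof. by move=> cg Rg x y; apply. Qed.

Lemma con_join a b : is_con (join a b).
Proof. exact: con_Cg. Qed.

Lemma subl_join a b : subrel a (join a b).
Proof. by move=> x y xy; apply: sub_Cg; left. Qed.

Lemma subr_join a b : subrel b (join a b).
Proof. by move=> x y xy; apply: sub_Cg; right. Qed.

Lemma join_sub a b g :
  is_con g -> subrel a g -> subrel b g -> subrel (join a b) g.
Proof. by move=> cg ag bg; apply: Cg_sub => // x y [/ag|/bg]. Qed.

Lemma subrel_trans a b d : subrel a b -> subrel b d -> subrel a d.
Proof. by move=> ab bd x y /ab/bd. Qed.

Lemma subrel_anti a b : subrel a b -> subrel b a -> a = b.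
Proof. by move=> ab ba; apply: prel_ext => x y; split; [apply: ab|apply: ba]. Qed.

Lemma join_mono a a' b b' :
  subrel a a' -> subrel b b' -> subrel (join a b) (join a' b').
Proof.
move=> aa bb; apply: join_sub; first exact: con_join.
  by apply: subrel_trans aa _; apply: subl_join.
by apply: subrel_trans bb _; apply: subr_join.
Qed.

Lemma join_absorb a b d : is_con d -> subrel b d -> join (join a b) d = join a d.
Proof.
move=> cd bd; apply: subrel_anti.
  apply: join_sub; [exact: con_join | | exact: subr_join].
  exact: join_mono.
by apply: join_mono => //; apply: subl_join.
Qed.

(** * Transitive closures and joins *)

Fixpoint rel_iter (M : prel A) (n : nat) : prel A :=
  if n is n'.+1 then fun x z => exists y, M x y /\ rel_iter M n' y z else @Delta A.

Lemma rel_iter_refl (M : prel A) : (forall x, M x x) ->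
  forall n x, rel_iter M n x x.
Proof. by move=> Mxx; elim=> //= n IH x; exists x. Qed.

Lemma rel_iter_le (M : prel A) m n : (forall x, M x x) -> m <= n ->
  subrel (rel_iter M m) (rel_iter M n).
Proof.
move=> Mxx; elim: m n => [|m IH] n mn x y.
  by move=> <-; apply: rel_iter_refl.
case: n mn => // n mn [z [xz zy]].
by exists z; split=> //; apply: IH zy.
Qed.

Lemma rel_iter_cat (M : prel A) m n x y z :
  rel_iter M m x y -> rel_iter M n y z -> rel_iter M (m + n) x z.
Proof.
elim: m x => [|m IH] x /=; first by move=> ->.
by case=> w [xw wy] yz; exists w; split=> //; apply: IH.
Qed.

Lemma rel_iter_sym (M : prel A) : (forall x y, M x y -> M y x) ->
  forall n x y, rel_iter M n x y -> rel_iter M n y x.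
Proof.
move=> Msym; elim=> [|n IH] x y; first by move=> ->.
case=> w [xw /IH yw]; rewrite -addn1.
by apply: (rel_iter_cat yw); exists x; split=> //; apply: Msym.
Qed.

Lemma rel_iter_op (M : prel A) :
  (forall (f : sym S) (u v : 'I_(arity f) -> A),
      (forall i, M (u i) (v i)) -> M (op A f u) (op A f v)) ->
  forall n (f : sym S) (u v : 'I_(arity f) -> A),
    (forall i, rel_iter M n (u i) (v i)) -> rel_iter M n (op A f u) (op A f v).
Proof.
move=> Mop; elim=> [|n IH] f u v /= uv.
  by congr op; apply: functional_extensionality.
have [w uwv] := skolem uv.
exists (op A f w); split; first by apply: Mop => i; case: (uwv i).
by apply: IH => i; case: (uwv i).
Qed.

(** Compatibility with the operations rests on finite arity: chains are padded by reflexivity to a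
    common length and then combined link by link. *)
Lemma con_rel_iter (M : prel A) :
  (forall x, M x x) -> (forall x y, M x y -> M y x) ->
  (forall (f : sym S) (u v : 'I_(arity f) -> A),
      (forall i, M (u i) (v i)) -> M (op A f u) (op A f v)) ->
  is_con (fun x y => exists n, rel_iter M n x y).
Proof.
move=> Mxx Msym Mop; split; first by move=> x; exists 0.
split; first by move=> x y [n xy]; exists n; apply: rel_iter_sym.
split.
  by move=> x y z [m xy] [n yz]; exists (m + n); apply: rel_iter_cat xy yz.
move=> f u v uv; have [k uvk] := skolem uv.
exists (\max_i k i); apply: rel_iter_op => // i.
by apply: rel_iter_le (uvk i) => //; apply: leq_bigmax.
Qed.

Lemma rel_iter_sub (M E : prel A) : (forall x, E x x) ->
  (forall x y z, E x y -> E y z -> E x z) -> subrel M E ->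
  forall n, subrel (rel_iter M n) E.
Proof.
move=> Exx Etr ME; elim=> [|n IH] x y /=; first by move=> ->.
by case=> z [/ME xz /IH]; apply: Etr.
Qed.

(** The join is the transitive closure of the composite of [a], [b], [a]. Later [E] is an
    implication between memberships in [d], which is a preorder but not visibly a congruence. *)
Lemma join_preorder a b (E : prel A) : is_con a -> is_con b ->
  (forall x, E x x) -> (forall x y z, E x y -> E y z -> E x z) ->
  subrel a E -> subrel b E -> subrel (join a b) E.
Proof.
move=> ca cb Exx Etr aE bE x y.
(* Three factors make the composite symmetric. *)
pose M x z := exists y y', [/\ a x y, b y y' & a y' z].
have Mxx z : M z z by exists z, z; split; apply: con_refl.
have cM : is_con (fun x y => exists n, rel_iter M n x y).
  apply: con_rel_iter => //.
    move=> u v [w [w' [? ? ?]]].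
    by exists w', w; split; apply: con_sym.
  move=> f u v /skolem[w uwv].
  have [w' {}uwv] := skolem uwv.
  by exists (op A f w), (op A f w'); split; apply: con_op => // i; case: (uwv i).
case/(_ _ cM).
  move=> u v uv; exists 1; exists v; split=> //.
  case: uv => uv; first by exists v, v; split=> //; apply: con_refl.
  by exists u, v; split=> //; apply: con_refl.
move=> n; apply: rel_iter_sub => // u v [w [w' [/aE uw /bE ww' /aE w'v]]].
by apply: (Etr _ w) => //; apply: (Etr _ w').
Qed.

(* The geometric form of the modular law: a parallelogram with sides in [a] and
   [b] transports [g] from one [a]-side to the other. *)
Lemma shifting a b g : con_modular A -> is_con a -> is_con b -> is_con g ->
  subrel (meet a b) g -> forall p q r s,
  a p q -> b p r -> b q s -> a r s -> g r s -> g p q.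
Proof.
move=> modA ca cb cg abg p q r s apq bpr bqs ars grs.
have cga := con_meet cg ca.
(* The path [p], [r], [s], [q] runs through [b], [meet g a], [b]; the modular law applies because
   [meet g a] lies below [a]. *)
have : meet (join (meet g a) b) a p q.
  split=> //; apply: (@con_trans _ (con_join _ _) r); first exact: subr_join.
  apply: (@con_trans _ (con_join _ _) s); first exact: subl_join.
  by apply: subr_join; apply: con_sym.
move/(modA _ _ _ cga cb ca) => /(_ (fun x y => @proj2 _ _)).
apply: join_sub => // x y; first by case.
by case=> ? ?; apply: abg.
Qed.
End Congruences.

(** * Centrality *)

Fixpoint rename (S : signature) (X Y : Type) (h : X -> Y) (t : term S X) :
    term S Y :=
  match t with
  | Var x => Var (h x)
  | App f ts => App f (fun i => rename h (ts i))
  end.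

Lemma eval_ext (S : signature) (A : algebra S) (X : Type) (v w : X -> A)
  (t : term S X) : (forall x, v x = w x) -> eval v t = eval w t.
Proof. by move=> /functional_extensionality ->. Qed.

Lemma eval_rename (S : signature) (A : algebra S) (X Y : Type) (h : X -> Y)
  (v : Y -> A) (t : term S X) : eval v (rename h t) = eval (fun x => v (h x)) t.
Proof.
by elim: t => //= f ts IH; congr op; apply: functional_extensionality.
Qed.

(** * A congruence as a subalgebra of the square *)

Section ConAlg.
Variables (S : signature) (A : algebra S) (b : prel A) (cb : is_con b).

Definition con_alg : algebra S :=
  @Algebra S {p : A * A | b p.1 p.2} (fun f ps =>
    exist (fun p => b p.1 p.2)
      (op A f (fun i => (sval (ps i)).1), op A f (fun i => (sval (ps i)).2))
      (con_op cb (fun i => proj2_sig (ps i)))).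

Definition con_pair (x y : A) (bxy : b x y) : con_alg :=
  exist (fun p => b p.1 p.2) (x, y) bxy.

Definition con_diag (x : A) : con_alg := con_pair (con_refl cb x).

Definition fst_rel (d : prel A) : prel con_alg :=
  fun p q => d (sval p).1 (sval q).1.

Definition snd_rel (d : prel A) : prel con_alg :=
  fun p q => d (sval p).2 (sval q).2.

Lemma con_alg_eq (p q : con_alg) :
  (sval p).1 = (sval q).1 -> (sval p).2 = (sval q).2 -> p = q.
Proof.
case: p q => [[x y] xy] [[z t] zt] /= xz yt; subst.
by congr exist; apply: proof_irrelevance.
Qed.

Lemma con_fst_rel d : is_con d -> is_con (fst_rel d).
Proof.
move=> cd; split; first by move=> p; apply: (con_refl cd).
split; first by move=> p q; apply: (con_sym cd).
split; first by move=> p q r; apply: (con_trans cd).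
by move=> f u v uv; apply: (con_op cd).
Qed.

Lemma con_snd_rel d : is_con d -> is_con (snd_rel d).
Proof.
move=> cd; split; first by move=> p; apply: (con_refl cd).
split; first by move=> p q; apply: (con_sym cd).
split; first by move=> p q r; apply: (con_trans cd).
by move=> f u v uv; apply: (con_op cd).
Qed.

Lemma eval_con_alg (X : Type) (v : X -> con_alg) (t : term S X) :
  sval (eval v t) =
  (eval (fun x => (sval (v x)).1) t, eval (fun x => (sval (v x)).2) t).
Proof.
elim: t => [x|f ts IH] /=; first by case: (sval _).
by congr pair; congr op; apply: functional_extensionality => i; rewrite IH.
Qed.

(** This makes modularity and semidegeneracy available inside [b] itself. *)
Lemma models_con_alg Sigma : models Sigma A -> models Sigma con_alg.
Proof.
by move=> HA e He v; apply: con_alg_eq; rewrite !eval_con_alg /=; apply: HA.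
Qed.
End ConAlg.

Section Centrality.
Variables (S : signature) (A : algebra S).
Implicit Types a b d g : prel A.

(** These are the 2-by-2 matrices of Freese and McKenzie, each row being an element of the
    subalgebra [b]. *)
Definition con_matrix a b (cb : is_con b) : prel (con_alg cb) := fun p q =>
  exists (t : term S (nat + nat)) (x y u w : nat -> A),
    [/\ forall i, a (x i) (y i), forall j, b (u j) (w j),
        sval p = (eval (sv x u) t, eval (sv x w) t) &
        sval q = (eval (sv y u) t, eval (sv y w) t)].

Lemma con_matrix_refl a b (cb : is_con b) : is_con a ->
  forall p, con_matrix a (cb := cb) p p.
Proof.
move=> ca [[x y] xy]; exists (Var (inr 0)).
exists (fun _ => x), (fun _ => x), (fun _ => x), (fun _ => y).
by split=> // i; apply: con_refl.
Qed.

Lemma con_matrix_sym a b (cb : is_con b) : is_con a ->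
  forall p q, con_matrix a (cb := cb) p q -> con_matrix a q p.
Proof.
move=> ca p q [t [x [y [u [w [xy uw ep eq]]]]]].
by exists t, y, x, u, w; split=> // i; apply: con_sym.
Qed.

(* The variables of the terms witnessing the entries are made disjoint through
   the bijection between ['I_n * nat] and a subset of [nat]. *)
Lemma con_matrix_op a b (cb : is_con b) : is_con a ->
  forall (f : sym S) (ps qs : 'I_(arity f) -> con_alg cb),
    (forall i, con_matrix a (ps i) (qs i)) ->
    con_matrix a (op (con_alg cb) f ps) (op (con_alg cb) f qs).
Proof.
move=> ca f ps qs /skolem[t] /skolem[x] /skolem[y] /skolem[u] /skolem[w] H.
(* A default value for numbers that code no pair; it exists even when [f] has arity 0. *)
pose c := (sval (op (con_alg cb) f ps)).1.
pose glue (z : 'I_(arity f) -> nat -> A) (m : nat) : A :=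
  if unpickle m is Some (i, k) then z i k else c.
have glueE z i k : glue z (pickle (i, k)) = z i k by rewrite /glue pickleK.
have glueR g z z' : is_con g -> (forall i k, g (z i k) (z' i k)) ->
    forall m, g (glue z m) (glue z' m).
  move=> cg zz' m; rewrite /glue; case: (unpickle m) => [[i k]|] //.
  exact: con_refl.
pose h (i : 'I_(arity f)) (z : nat + nat) : nat + nat :=
  match z with inl k => inl (pickle (i, k)) | inr k => inr (pickle (i, k)) end.
have E z z' : eval (sv (glue z) (glue z')) (App f (fun i => rename (h i) (t i)))
    = op A f (fun i => eval (sv (z i) (z' i)) (t i)).
  rewrite /=; congr op; apply: functional_extensionality => i; rewrite eval_rename.
  by apply: eval_ext => -[k|k] /=; rewrite glueE.
exists (App f (fun i => rename (h i) (t i))), (glue x), (glue y), (glue u), (glue w).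
split; try by apply: glueR => // i k; case: (H i).
  by rewrite !E; congr pair; congr op; apply: functional_extensionality => i;
     case: (H i) => _ _ -> _.
by rewrite !E; congr pair; congr op; apply: functional_extensionality => i;
   case: (H i) => _ _ _ ->.
Qed.

Definition linked a b (cb : is_con b) (G : prel (con_alg cb)) :=
  forall x y, a x y -> G (con_diag cb x) (con_diag cb y).

Definition saturates d b (cb : is_con b) (G : prel (con_alg cb)) :=
  forall p q, G p q -> d (sval p).1 (sval p).2 -> d (sval q).1 (sval q).2.

(* [G] can be taken to be the congruence of [b], as a subalgebra of [A * A],
   generated by the pairs of diagonal elements of [a]. *)
Lemma centralizesP a b d (cb : is_con b) : is_con a -> centralizes a b d <->
  exists G : prel (con_alg cb), [/\ is_con G, linked a G & saturates d G].
Proof.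
move=> ca; split.
  move=> Cabd; exists (fun p q => exists n, rel_iter (con_matrix a (cb := cb)) n p q).
  split.
  - apply: con_rel_iter.
    + exact: con_matrix_refl.
    + exact: con_matrix_sym.
    + exact: con_matrix_op.
  - move=> x y xy; exists 1; exists (con_diag cb y); split=> //.
    exists (Var (inl 0)), (fun _ => x), (fun _ => y), (fun _ => x), (fun _ => x).
    by split=> // _; apply: con_refl.
  - move=> p q [n]; move: p q.
    (* Preservation of [d] is a preorder on rows, so one matrix suffices, and there it is the term
       condition. *)
    apply: (@rel_iter_sub _ _ _
      (fun p q : con_alg cb => d (sval p).1 (sval p).2 -> d (sval q).1 (sval q).2)) => //.
      by move=> p q r pq qr /pq/qr.
    by move=> p q [t [x [y [u [w [xy uw -> ->]]]]]] /=; apply: Cabd.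
case=> G [cG lG sG] t x y u w xy uw.
pose pr j := @con_pair _ _ _ cb (u j) (w j) (uw j).
(* With [z] on the diagonal, evaluating [t] in the subalgebra yields a whole row of the matrix. *)
pose v (z : nat -> A) (k : nat + nat) : con_alg cb :=
  match k with inl i => con_diag cb (z i) | inr j => pr j end.
have vE z : sval (eval (v z) t) = (eval (sv z u) t, eval (sv z w) t).
  by rewrite eval_con_alg; congr pair; apply: eval_ext => -[].
have := sG (eval (v x) t) (eval (v y) t); rewrite !vE /=; apply.
by apply: con_eval => // -[i|j]; [apply: lG|apply: con_refl].
Qed.

(** The join of the two witnesses is a witness: the pairs whose diagonal images it relates form a
    congruence, and preservation of [d] is a preorder. *)
Lemma centralizes_joinl a a' b d : is_con a -> is_con a' -> is_con b ->
  centralizes a b d -> centralizes a' b d -> centralizes (join a a') b d.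
Proof.
move=> ca ca' cb /(centralizesP d cb ca)[G [cG lG sG]].
move=> /(centralizesP d cb ca')[G' [cG' lG' sG']].
apply/(centralizesP d cb (con_join a a')).
exists (join G G'); split; first exact: con_join.
  have cD : is_con (fun x y => join G G' (con_diag cb x) (con_diag cb y)).
    have cj := con_join G G'.
    split; first by move=> x; apply: (con_refl cj).
    split; first by move=> x y; apply: (con_sym cj).
    split; first by move=> x y z; apply: (con_trans cj).
    move=> f u v uv; have := con_op cj uv.
    by congr join; apply: con_alg_eq.
  move=> x y; move: x y; apply: (join_sub cD) => x y xy.
    by apply: subl_join; apply: lG.
  by apply: subr_join; apply: lG'.
move=> p q; move: p q; apply: (@join_preorder _ _ _ _
  (fun p q : con_alg cb => d (sval p).1 (sval p).2 -> d (sval q).1 (sval q).2)) => //.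
by move=> p q r pq qr /pq/qr.
Qed.

Lemma centralizes_sub a a' b b' d : subrel a' a -> subrel b' b ->
  centralizes a b d -> centralizes a' b' d.
Proof.
by move=> aa bb C t x y u w xy uw; apply: C => i; [apply: aa|apply: bb].
Qed.

Lemma centralizes_meet a b d d' : centralizes a b d -> centralizes a b d' ->
  centralizes a b (meet d d').
Proof.
move=> C C' t x y u w xy uw [D D'].
by split; [apply: C D|apply: C' D'].
Qed.

Lemma centralizes_subr a b d : is_con d -> subrel b d -> centralizes a b d.
Proof.
move=> cd bd t x y u w xy uw _; apply: con_eval => // -[i|j] /=.
  exact: con_refl.
exact: bd.
Qed.

Lemma centralizes_subl a b d : is_con d -> subrel a d -> centralizes a b d.
Proof.
move=> cd ad t x y u w xy uw D.
have E c : d (eval (sv x c) t) (eval (sv y c) t).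
  by apply: con_eval => // -[i|j] /=; [apply: ad|apply: con_refl].
apply: (con_trans cd (con_sym cd (E u))); exact: (con_trans cd D (E w)).
Qed.

Lemma con_comm a b : is_con (comm a b).
Proof.
have -> : comm a b = fun x y => forall g, is_con g /\ centralizes a b g -> g x y.
  by apply: prel_ext => x y; split=> [xy g []|xy g cg Rg]; apply: xy.
by apply: con_forall => g [].
Qed.

Lemma centralizes_comm a b : centralizes a b (comm a b).
Proof.
move=> t x y u w xy uw D d cd C; apply: (C t x y u w) => //.
exact: D.
Qed.

Lemma comm_sub a b d : is_con d -> centralizes a b d -> subrel (comm a b) d.
Proof. by move=> cd C x y; apply. Qed.

Lemma comm_sub_meet a b : is_con a -> is_con b -> subrel (comm a b) (meet a b).
Proof.
move=> ca cb; apply: comm_sub; first exact: con_meet.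
by apply: centralizes_meet; [apply: centralizes_subl|apply: centralizes_subr].
Qed.

(* Shifting along the two coordinate kernels of [b] turns a [G]-related pair
   [(x, y), (x, y')] into [(y, y), (y, y')]. *)
Lemma saturates_vertical b d (cb : is_con b) (G : prel (con_alg cb)) :
  con_modular (con_alg cb) -> is_con d -> is_con G -> saturates d G ->
  subrel (meet (fst_rel (@Delta A)) G) (snd_rel d).
Proof.
move=> modb cd cG sG [[x y] xy] [[x' y'] xy'] [/= e xyG].
have {}e : x = x' by []; subst x'.
have yy' : b y y' by apply: (con_trans cb (con_sym cb xy)).
apply: (sG (con_diag cb y) (con_pair cb yy')); last exact: con_refl.
apply: (@shifting _ _ (fst_rel (@Delta A)) (snd_rel (@Delta A)) _ modb
  _ _ cG _ _ _ _ _ _ _ _ _ xyG) => //.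
- exact/con_fst_rel/con_Delta.
- exact/con_snd_rel/con_Delta.
- by move=> p q [e1 e2]; rewrite (con_alg_eq e1 e2); apply: con_refl.
Qed.

(** Intersecting [G] with [fst_rel a] ensures that the diagonal elements on the first coordinates of
    related [p] and [q] are [G]-related too. Shifting along these [G]-sides carries membership in
    [d'] from [p] to [q], with [saturates_vertical] as its hypothesis. *)
Lemma centralizes_up a b d d' (cb : is_con b) : con_modular (con_alg cb) ->
  is_con a -> is_con d -> is_con d' -> subrel d d' ->
  centralizes a b d -> centralizes a b d'.
Proof.
move=> modb ca cd cd' dd' /(centralizesP d cb ca)[G [cG lG sG]].
have vG := saturates_vertical modb cd cG sG.
apply/(centralizesP d' cb ca).
exists (meet G (fst_rel a)); split.
- by apply: con_meet => //; apply: con_fst_rel.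
- by move=> x y xy; split=> //; apply: lG.
move=> p q [Gpq apq] dp; apply: (con_sym cd').
apply: (@shifting _ _ (fst_rel (@Delta A)) G (snd_rel d') modb _ cG _ _
  q (con_diag cb (sval q).1) p (con_diag cb (sval p).1)) => //.
- exact/con_fst_rel/con_Delta.
- exact: con_snd_rel.
- by apply: subrel_trans vG _ => u v; apply: dd'.
- exact: con_sym.
- by apply: lG; apply: con_sym.
- by apply: (con_sym cd').
Qed.

(** Columns of a matrix become elements of [b]. Enlarging [G] by the congruence that [d] induces on
    both coordinates keeps [d] saturated and allows one shift. *)
Lemma centralizes_sym_sub a b d (cb : is_con b) : con_modular (con_alg cb) ->
  is_con a -> is_con d -> subrel d b -> centralizes a b d -> centralizes b a d.
Proof.
move=> modb ca cd db /(centralizesP d cb ca)[G [cG lG sG]].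
move=> t u w x y uw xy.
pose pr j := @con_pair _ _ _ cb (u j) (w j) (uw j).
pose v (z : nat -> A) (k : nat + nat) : con_alg cb :=
  match k with inl j => pr j | inr i => con_diag cb (z i) end.
have vE z : sval (eval (v z) t) = (eval (sv u z) t, eval (sv w z) t).
  by rewrite eval_con_alg; congr pair; apply: eval_ext => -[].
have Gv : G (eval (v x) t) (eval (v y) t).
  by apply: con_eval => // -[j|i]; [apply: con_refl|apply: lG].
have bv z := proj2_sig (eval (v z) t).
move: (vE x) (vE y) (bv x) (bv y) Gv.
set p := eval (v x) t; set q := eval (v y) t => ep eq.
rewrite -/(sval p) -/(sval q) ep eq /=.
set P := eval _ _ in ep *; set Q := eval _ _ in ep *.
set P' := eval _ _ in eq *; set Q' := eval _ _ in eq *.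
move=> PQ PQ' Gpq dPP'.
(* Here [d] below [b] is used: it makes the second row an element of the subalgebra. *)
have QQ' : b Q Q'.
  apply: (con_trans cb (con_sym cb PQ)); apply: (con_trans cb (db _ _ dPP')).
  exact: PQ'.
pose H := join G (meet (fst_rel d) (snd_rel d)).
have c1 : is_con (fst_rel (cb := cb) d) by apply: con_fst_rel.
have c2 : is_con (snd_rel (cb := cb) d) by apply: con_snd_rel.
have HQ : H (con_diag cb Q) (con_pair cb QQ').
  apply: (@shifting _ _ (fst_rel d) (snd_rel d) H modb c1 c2 (con_join _ _) _
    _ _ p q).
  - exact: subr_join.
  - exact: con_refl.
  - by rewrite /snd_rel ep /=; apply: con_refl.
  - by rewrite /snd_rel eq /=; apply: con_refl.
  - by rewrite /fst_rel ep eq.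
  - exact: subl_join.
suff: d (sval (con_diag cb Q)).1 (sval (con_diag cb Q)).2 ->
    d (sval (con_pair cb QQ')).1 (sval (con_pair cb QQ')).2.
  by apply; apply: con_refl.
move: HQ; move: (con_diag cb Q) (con_pair cb QQ').
apply: (@join_preorder _ _ _ _
  (fun p q : con_alg cb => d (sval p).1 (sval p).2 -> d (sval q).1 (sval q).2)) => //.
- exact: con_meet.
- by move=> r s r' rs sr /rs/sr.
move=> r s [r1 r2] dr; apply: (con_trans cd (con_sym cd r1)).
exact: (con_trans cd dr r2).
Qed.
End Centrality.

(** * Quotients *)

Definition complemented_above (S : signature) (A : algebra S) (th e : prel A) :=
  is_con e /\ exists f : prel A, is_con f /\
    releq (meet e f) th /\ releq (join e f) (@Nabla A).

Lemma complemented_above_sub (S : signature) (A : algebra S) (th e : prel A) :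
  complemented_above th e -> subrel th e.
Proof. by case=> _ [f [_ [m _]]] x y /m[]. Qed.

Section Quotients.
Variables (S : signature) (A : algebra S) (th : prel A) (cth : is_con th).
Local Notation Q := (quot_alg th).
Local Notation cl := (qclass th).

Lemma qrepK (X : Q) : cl (qrep X) = X.
Proof.
case: X => P exP; rewrite /qrep /=.
case: constructive_indefinite_description => a /= ea; subst P.
by congr exist; apply: proof_irrelevance.
Qed.

Lemma qclass_eq x y : th x y -> cl x = cl y.
Proof.
move=> xy; apply: eq_sig_hprop => /=; first by move=> *; apply: proof_irrelevance.
apply: functional_extensionality => z; apply: propositional_extensionality.
split; first exact: (con_trans cth (con_sym cth xy)).
exact: (con_trans cth xy).
Qed.

Lemma qclass_inj x y : cl x = cl y -> th x y.
Proof. by case=> ->; apply: con_refl. Qed.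

Lemma qclassK x : th (qrep (cl x)) x.
Proof. by apply: qclass_inj; rewrite qrepK. Qed.

Lemma qclass_op (f : sym S) (u : 'I_(arity f) -> A) :
  cl (op A f u) = op Q f (fun i => cl (u i)).
Proof.
by apply: qclass_eq; apply: (con_op cth) => i; apply/(con_sym cth)/qclassK.
Qed.

Lemma qclass_eval (X : Type) (v : X -> A) (t : term S X) :
  cl (eval v t) = eval (A := Q) (fun x => cl (v x)) t.
Proof.
elim: t => [//|f ts IH] /=; rewrite qclass_op /=.
by congr (cl (op A f _)); apply: functional_extensionality => i; rewrite IH.
Qed.

Lemma eval_qrep (X : Type) (v : X -> Q) (t : term S X) :
  eval v t = cl (eval (fun x => qrep (v x)) t).
Proof. by rewrite qclass_eval; apply: eval_ext => x; rewrite qrepK. Qed.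

Lemma models_quot Sigma : models Sigma A -> models Sigma Q.
Proof. by move=> HA e He v; rewrite !eval_qrep (HA e He). Qed.

(** On congruences this inverts [quot_rel], giving the correspondence theorem. *)
Definition pull (R : prel Q) : prel A := fun x y => R (cl x) (cl y).

Lemma pullK (R : prel Q) : quot_rel (pull R) = R.
Proof. by apply: prel_ext => X Y; rewrite /quot_rel /pull !qrepK. Qed.

Lemma quot_relE (d : prel A) x y : is_con d -> subrel th d ->
  quot_rel (th := th) d (cl x) (cl y) <-> d x y.
Proof.
move=> cd thd; have E z : d (qrep (cl z)) z by apply/thd/qclassK.
split=> H.
  by apply: (con_trans cd (con_sym cd (E x))); apply: (con_trans cd H).
apply: (con_trans cd (E x)); apply: (con_trans cd H); exact: (con_sym cd).
Qed.

Lemma quot_relK (d : prel A) : is_con d -> subrel th d ->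
  pull (quot_rel d) = d.
Proof. by move=> cd thd; apply: prel_ext => x y; apply: quot_relE. Qed.

Lemma con_pull (R : prel Q) : is_con R -> is_con (pull R).
Proof.
move=> cR; split; first by move=> x; apply: (con_refl cR).
split; first by move=> x y; apply: (con_sym cR).
split; first by move=> x y z; apply: (con_trans cR).
by move=> f u v uv; rewrite /pull !qclass_op; apply: (con_op cR).
Qed.

Lemma sub_pull (R : prel Q) : is_con R -> subrel th (pull R).
Proof. by move=> cR x y xy; rewrite /pull (qclass_eq xy); apply: (con_refl cR). Qed.

Lemma con_quot_rel (d : prel A) : is_con d -> subrel th d ->
  is_con (quot_rel (th := th) d).
Proof.
move=> cd thd; split; first by move=> x; apply: (con_refl cd).
split; first by move=> x y; apply: (con_sym cd).
split; first by move=> x y z; apply: (con_trans cd).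
move=> f u v uv; apply/(quot_relE _ _ cd thd).
exact: (con_op cd).
Qed.

Lemma pull_sub (R : prel Q) (d : prel A) : is_con d -> subrel th d ->
  subrel R (quot_rel d) -> subrel (pull R) d.
Proof. by move=> cd thd Rd x y /Rd/quot_relE; apply. Qed.

(** Terms commute with the quotient map, and every valuation in the quotient lifts through
    representatives. *)
Lemma pull_centralizes (a b d : prel Q) :
  centralizes a b d <-> centralizes (pull a) (pull b) (pull d).
Proof.
have E (z z' : nat -> A) t : cl (eval (sv z z') t) =
    eval (A := Q) (sv (fun i => cl (z i)) (fun i => cl (z' i))) t.
  by rewrite qclass_eval; apply: (@eval_ext S Q) => -[].
split=> C t x y u w xy uw; first by rewrite /pull !E; apply: C.
have E' (z z' : nat -> Q) : eval (A := Q) (sv z z') t =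
    cl (eval (sv (fun i => qrep (z i)) (fun i => qrep (z' i))) t).
  by rewrite E; apply: (@eval_ext S Q) => -[i|i] /=; rewrite qrepK.
rewrite !E'; apply: C => i; first by rewrite /pull !qrepK.
by rewrite /pull !qrepK.
Qed.

Lemma join_quot_rel (e f : prel A) : is_con e -> is_con f ->
  subrel th e -> subrel th f -> releq (join e f) (@Nabla A) ->
  releq (join (quot_rel (th := th) e) (quot_rel f)) (@Nabla Q).
Proof.
move=> ce cf the thf ef X Y; split=> // _ g cg gef.
rewrite -(qrepK X) -(qrepK Y); have : join e f (qrep X) (qrep Y) by apply/ef.
have cp := con_pull cg; apply: (join_sub cp) => x y xy; apply: gef.
  by left; apply/quot_relE.
by right; apply/quot_relE.
Qed.

Lemma complemented_quot_rel (e : prel A) : complemented_above th e ->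
  complemented (quot_rel (th := th) e).
Proof.
case=> ce [f [cf [m j]]].
have the : subrel th e by move=> x y /m[].
have thf : subrel th f by move=> x y /m[].
split; first exact: con_quot_rel.
exists (quot_rel f); split; first exact: con_quot_rel.
split; last exact: join_quot_rel.
move=> X Y; split=> [/m/qclass_eq|->]; first by rewrite !qrepK.
by apply/m; apply: con_refl.
Qed.

Lemma complemented_pull (R : prel Q) : complemented R ->
  complemented_above th (pull R).
Proof.
case=> cR [T [cT [m j]]]; split; first exact: con_pull.
exists (pull T); split; first exact: con_pull.
split=> x y; split=> //.
- by move/m/qclass_inj.
- by move=> /qclass_eq xy; apply/m.
move=> _ g cg gRT.
(* Since [g] contains [th], it descends to the quotient, where [R] and [T] join to [Nabla]. *)
have thg : subrel th g.
  by move=> u v uv; apply: gRT; left; apply: sub_pull.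
apply/(quot_relE _ _ cg thg).
have /j : Nabla (cl x) (cl y) by [].
apply: join_sub; first exact: con_quot_rel.
  by move=> X Y XY; apply: gRT; left; rewrite /pull !qrepK.
by move=> X Y XY; apply: gRT; right; rewrite /pull !qrepK.
Qed.

(** The correspondence theorem moves the lifting property into the congruence lattice of [A], where
    [th] and [rho th] can be compared. *)
Lemma CBLP_above : CBLP th <-> forall e, complemented_above th e ->
  exists a : prel A, complemented a /\ join a th = e.
Proof.
split=> H.
  move=> e ae; have [a [ca E]] := H _ (complemented_quot_rel ae).
  exists a; split=> //; move/prel_ext: E => /(congr1 pull).
  rewrite !quot_relK //; first [exact: subr_join | exact: con_join | idtac].
  - by case: ae.
  - exact: complemented_above_sub.
move=> b /complemented_pull/H[a [ca E]].
by exists a; split=> //; rewrite E pullK.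
Qed.
End Quotients.

(** * Finitely generated congruences *)

(** Serves the finiteness of arities, for directed unions, and that of the signature, for the finite
    generation of [Nabla]. *)
Lemma incl_bound (I : finType) (T : Type) (s : I -> list T) :
  exists l, forall i, List.incl (s i) l.
Proof.
suff [l Hl] : exists l, forall i, i \in enum I -> List.incl (s i) l.
  by exists l => i; apply: Hl; rewrite mem_enum.
elim: (enum I) => [|j r [l Hl]]; first by exists nil.
exists (s j ++ l) => i; rewrite inE => /orP[/eqP->|/Hl il].
  exact: List.incl_appl.
exact: List.incl_appr.
Qed.

Section FinitelyGenerated.
Variables (S : signature) (A : algebra S).

Lemma con_directed (T : Type) (L : list T -> prel A) :
  (forall s, is_con (L s)) ->
  (forall s s', List.incl s s' -> subrel (L s) (L s')) ->
  is_con (fun x y => exists s, L s x y).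
Proof.
move=> cL mL; split; first by move=> x; exists nil; apply: con_refl.
split; first by move=> x y [s xy]; exists s; apply: con_sym.
split.
  move=> x y z [s xy] [s' yz]; exists (s ++ s').
  apply: (con_trans (cL _) (y := y)).
    by apply: mL xy; apply: List.incl_appl; apply: List.incl_refl.
  by apply: mL yz; apply: List.incl_appr; apply: List.incl_refl.
move=> f u v /skolem[s uv]; have [l sl] := incl_bound s.
by exists l; apply: con_op => // i; apply: mL (uv i).
Qed.

(** Filtering by [P] lets one list serve two congruences at once, as in [join_fg_con]. *)
Definition fg_con (P : prel A) (s : list (A * A)) : prel A :=
  Cg (fun x y => List.In (x, y) s /\ P x y).

Lemma fg_con_sub (P : prel A) s : is_con P -> subrel (fg_con P s) P.
Proof. by move=> cP; apply: Cg_sub => // x y []. Qed.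

Lemma fg_con_mono (P : prel A) s s' :
  List.incl s s' -> subrel (fg_con P s) (fg_con P s').
Proof.
move=> ss'; apply: Cg_sub; first exact: con_Cg.
by move=> x y [xy Pxy]; apply: sub_Cg; split=> //; apply: ss'.
Qed.

(** Finite subjoins form a directed family whose union is the whole join, so each generating pair
    lies in one of them; the finitely many index lists are concatenated. *)
Lemma compact_fg_con (P : prel A) s : compact (fg_con P s).
Proof.
split; first exact: con_Cg.
move=> I F cF sF.
pose L (l : list I) : prel A := Cg (fun x y => exists i, List.In i l /\ F i x y).
have mL l l' : List.incl l l' -> subrel (L l) (L l').
  move=> ll'; apply: Cg_sub; first exact: con_Cg.
  by move=> x y [i [il xy]]; apply: sub_Cg; exists i; split=> //; apply: ll'.
have cG : is_con (fun x y => exists l, L l x y).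
  by apply: con_directed => // l; apply: con_Cg.
have GF : subrel (bigjoin F) (fun x y => exists l, L l x y).
  apply: Cg_sub => // x y [i xy]; exists [:: i]; apply: sub_Cg.
  by exists i; split=> //; left.
suff [l Hl] : exists l, forall x y, List.In (x, y) s -> P x y -> L l x y.
  by exists l; apply: Cg_sub; [apply: con_Cg | move=> x y []; apply: Hl].
have : forall x y, List.In (x, y) s -> P x y -> exists l, L l x y.
  by move=> x y xy Pxy; apply: GF; apply: sF; apply: sub_Cg.
elim: s {sF} => [|[u v] s IH] H; first by exists nil.
have [|l Hl] := IH; first by move=> x y xy; apply: H; right.
have [l' Hl'] : exists l', P u v -> L l' u v.
  have [Puv|nPuv] := excluded_middle_informative (P u v); last by exists nil.
  by have [|l' ?] := H u v _ Puv; [left | exists l'].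
exists (l ++ l') => x y [[<- <-] /Hl'|xy /(Hl _ _ xy)].
  by apply: mL; apply: List.incl_appr; apply: List.incl_refl.
by apply: mL; apply: List.incl_appl; apply: List.incl_refl.
Qed.

Lemma join_fg_con (g h : prel A) x y : is_con g -> is_con h -> join g h x y ->
  exists s, join (fg_con g s) (fg_con h s) x y.
Proof.
move=> cg ch.
have cG : is_con (fun x y => exists s, join (fg_con g s) (fg_con h s) x y).
  apply: con_directed => [s|s s' ss']; first exact: con_join.
  by apply: join_mono; apply: fg_con_mono.
move: x y; apply: (join_sub cG) => x y xy; exists [:: (x, y)].
  by apply: subl_join; apply: sub_Cg; split=> //; left.
by apply: subr_join; apply: sub_Cg; split=> //; left.
Qed.
End FinitelyGenerated.

(** * Semidegenerate congruence modular varieties *)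

Lemma con_rho (S : signature) (A : algebra S) (th : prel A) : is_con (rho th).
Proof.
have -> : rho th = fun x y => forall g, prime_con g /\ subrel th g -> g x y.
  by apply: prel_ext => x y; split=> [xy g []|xy g cg Rg]; apply: xy.
by apply: con_forall => g [[]].
Qed.

Lemma sub_rho (S : signature) (A : algebra S) (th : prel A) : subrel th (rho th).
Proof. by move=> x y xy phi _; apply. Qed.

Lemma prime_centralizes (S : signature) (A : algebra S) (phi a b : prel A) :
  prime_con phi -> is_con a -> is_con b -> centralizes a b phi ->
  subrel a phi \/ subrel b phi.
Proof. by move=> [cphi [_ P]] ca cb C; apply: P => //; apply: comm_sub. Qed.

Lemma prime_meet (S : signature) (A : algebra S) (phi a b : prel A) :
  prime_con phi -> is_con a -> is_con b -> subrel (meet a b) phi ->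
  subrel a phi \/ subrel b phi.
Proof.
move=> [cphi [_ P]] ca cb abphi; apply: P => //.
exact: subrel_trans (comm_sub_meet ca cb) abphi.
Qed.

Section Variety.
Variables (S : signature) (Sigma : term S nat * term S nat -> Prop).
Hypothesis HCM : forall B : algebra S, models Sigma B -> con_modular B.
Hypothesis Hsd : forall B : algebra S, models Sigma B -> semidegenerate_alg B.

(* The class of [e] becomes a one-element subalgebra of [A / d]. *)
Lemma con_eq_Nabla (A : algebra S) (d : prel A) (e : A) :
  models Sigma A -> is_con d ->
  (forall f : sym S, d e (op A f (fun _ => e))) -> forall x y, d x y.
Proof.
move=> HA cd de x y; apply: NNPP => nxy.
apply: (Hsd (models_quot cd HA)).
  by exists (qclass d x), (qclass d y) => /(qclass_inj cd).
exists (qclass d e) => f; rewrite -(qclass_op cd).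
by apply: (qclass_eq cd); apply: (con_sym cd).
Qed.

Section Algebra.
Variables (A : algebra S) (HA : models Sigma A).
Implicit Types a b d e m th phi : prel A.

(** * Calculus of centrality in the variety *)

Lemma modular_con_alg b (cb : is_con b) : con_modular (con_alg cb).
Proof. by apply: HCM; apply: models_con_alg. Qed.

Lemma centralizes_le a b d d' : is_con a -> is_con b -> is_con d -> is_con d' ->
  subrel d d' -> centralizes a b d -> centralizes a b d'.
Proof.
move=> ca cb cd cd' dd'.
exact: (centralizes_up (@modular_con_alg _ cb) ca cd cd' dd').
Qed.

Lemma centralizes_sym a b d : is_con a -> is_con b -> is_con d ->
  centralizes a b d -> centralizes b a d.
Proof.
move=> ca cb cd C.
(* [centralizes_sym_sub] wants a congruence below [b]: centrality is swapped at [meet d b] and then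
   raised to [d]. *)
have cdb := con_meet cd cb.
apply: (@centralizes_le _ _ (meet d b)) => //; first by move=> x y [].
apply: (centralizes_sym_sub (@modular_con_alg _ cb)) => //; first by move=> x y [].
by apply: centralizes_meet => //; apply: centralizes_subr.
Qed.

Lemma centralizes_joinr a b b' d : is_con a -> is_con b -> is_con b' ->
  is_con d -> centralizes a b d -> centralizes a b' d ->
  centralizes a (join b b') d.
Proof.
move=> ca cb cb' cd C C'; apply: centralizes_sym => //; first exact: con_join.
by apply: centralizes_joinl => //; apply: centralizes_sym.
Qed.

Lemma centralizes_join2 a b d : is_con a -> is_con b -> is_con d ->
  centralizes a b d -> centralizes (join a d) (join b d) d.
Proof.
move=> ca cb cd C; have cj := con_join a d.
apply: centralizes_joinr => //; last exact: centralizes_subr.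
by apply: centralizes_joinl => //; apply: centralizes_subl.
Qed.

Lemma centralizes_of_meet a b d : is_con a -> is_con b -> is_con d ->
  subrel (meet a b) d -> centralizes a b d.
Proof.
move=> ca cb cd abd.
apply: (@centralizes_le _ _ (meet a b)) => //; first exact: con_meet.
by apply: centralizes_meet; [apply: centralizes_subl|apply: centralizes_subr].
Qed.

(* In the subalgebra [m] of [A * A] the diagonal lies in a single class of the
   congruence witnessing centrality, so that congruence is total. *)
Lemma centralizes_Nabla m d : is_con m -> is_con d ->
  centralizes (@Nabla A) m d -> subrel m d.
Proof.
move=> cm cd /(centralizesP d cm (con_Nabla A))[G [cG lG sG]] x y xy.
apply: (sG (con_diag cm x) (con_pair cm xy)); last exact: con_refl.
apply: (con_eq_Nabla (e := con_diag cm x) _ cG); first exact: models_con_alg.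
move=> f; have -> : op (con_alg cm) f (fun=> con_diag cm x) =
    con_diag cm (op A f (fun=> x)) by apply: con_alg_eq.
exact: lG.
Qed.

(** A substitute for distributivity: both [d] and [b] centralize [a] modulo [d], hence so does their
    join [Nabla]. *)
Lemma sub_of_join_Nabla a b d : is_con a -> is_con b -> is_con d ->
  subrel (meet a b) d -> (forall x y, join d b x y) -> subrel a d.
Proof.
move=> ca cb cd abd dbN; apply: centralizes_Nabla => //.
have : centralizes (join d b) a d.
  apply: centralizes_joinl => //; first exact: centralizes_subl.
  by apply: centralizes_of_meet => // x y [? ?]; apply: abd.
exact: centralizes_sub.
Qed.

(** Each of [join a th] and [join b th] centralizes their meet modulo [th], hence so does [Nabla],
    and the meet falls below [th]. *)
Lemma complemented_join a th : is_con th -> complemented a ->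
  complemented_above th (join a th).
Proof.
move=> cth [ca [b [cb [ab jab]]]].
have [ca1 cb1] := (con_join a th, con_join b th).
split=> //; exists (join b th); split=> //; split; last first.
  move=> x y; split=> // _; have /jab : Nabla x y by [].
  by apply: join_mono; apply: subl_join.
move=> x y; split=> [|xy]; last by split; apply: subr_join.
have cm := con_meet ca1 cb1; move: x y; apply: centralizes_Nabla => //.
have C : centralizes (join a th) (join b th) th.
  apply: centralizes_join2 => //; apply: centralizes_of_meet => //.
  by move=> x y /ab ->; apply: con_refl.
have Cm : centralizes (join (join a th) (join b th))
    (meet (join a th) (join b th)) th.
  apply: centralizes_joinl => //.
    by apply: centralizes_sub C => // x y [].
  by apply: centralizes_sub (centralizes_sym ca1 cb1 cth C) => // x y [].
apply: centralizes_sub Cm => // x y _; have /jab : Nabla x y by [].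
by apply: join_mono; apply: subl_join.
Qed.

(** * Maximal and prime congruences *)

Lemma exists_max_con s : is_con s -> ~ (forall x y, s x y) ->
  exists phi, [/\ is_con phi, subrel s phi, ~ (forall x y, phi x y) &
    forall psi, is_con psi -> subrel phi psi -> ~ (forall x y, psi x y) ->
      subrel psi phi].
Proof.
move=> cs ns.
(* On an empty carrier [s] would be total. *)
have [e _] : exists e : A, True.
  by apply: NNPP => ne; apply: ns => x; case: ne; exists x.
(* Adding [s] to every set lets the empty chain be bounded by [s]. *)
pose up (X : A * A -> Prop) : prel A := fun x y => X (x, y) \/ s x y.
pose P (X : A * A -> Prop) := is_con (up X) /\ ~ (forall x y, up X x y).
pose X0 : A * A -> Prop := fun _ => False.
have up0 : up X0 = s by apply: prel_ext => x y; split; [case|right].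
have P0 : P X0 by rewrite /P up0.
have [F FP Ftot|X [[cX nX] maxX]] := @classical_sets.Zorn_bigcup (A * A) P.
  set U := classical_sets.bigcup F id.
  pose F' X := F X \/ X = X0.
  have F'P X : F' X -> P X by case=> [/FP|->].
  have F'tot X Y : F' X -> F' Y ->
      (forall p, X p -> Y p) \/ (forall p, Y p -> X p).
    case=> [FX|->]; last by left.
    case=> [FY|->]; last by right.
    exact: Ftot.
  have upU x y : up U x y <-> exists X, F' X /\ up X x y.
    split.
      case=> [[X FX xy]|xy]; first by exists X; split; left.
      by exists X0; rewrite up0; split=> //; right.
    case=> X [[FX|->]]; last by rewrite up0; right.
    by case=> xy; [left; exists X | right].
  (* Finitely many pairs of the union lie in one member of the chain. This is applied to two pairs
     for transitivity, to an arity for the operations, and to the symbols for properness. *)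
  have fin (I : finType) (u v : I -> A) : (forall i, up U (u i) (v i)) ->
      exists X, F' X /\ forall i, up X (u i) (v i).
    move=> uv; suff [X [FX Xuv]] : exists X, F' X /\
        forall i, i \in enum I -> up X (u i) (v i).
      by exists X; split=> // i; apply: Xuv; rewrite mem_enum.
    elim: (enum I) => [|j r [X [FX Xuv]]]; first by exists X0; split=> //; right.
    have [Y [FY Yuv]] := (upU _ _).1 (uv j).
    have [XY|YX] := F'tot X Y FX FY.
      exists Y; split=> // i; rewrite inE => /orP[/eqP->//|/Xuv].
      by case=> [/XY|]; [left|right].
    exists X; split=> // i; rewrite inE => /orP[/eqP->|/Xuv//].
    by case: Yuv => [/YX|]; [left|right].
  split.
    split; first by move=> x; right; apply: con_refl.
    split.
      move=> x y /upU[X [FX xy]]; apply/upU; exists X; split=> //.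
      exact: (con_sym (F'P _ FX).1).
    split.
      move=> x y z xy yz.
      have [|X [FX H]] := fin bool (fun i => if i then x else y)
        (fun i => if i then y else z); first by case.
      apply/upU; exists X; split=> //.
      exact: (con_trans (F'P _ FX).1 (H true) (H false)).
    move=> f u v /fin[X [FX uv]]; apply/upU; exists X; split=> //.
    exact: (con_op (F'P _ FX).1).
  (* By [con_eq_Nabla], one pair per symbol already forces totality, so some member of the chain
     would be total. *)
  move=> UN; have [|X [FX H]] := fin (sym S) (fun=> e) (fun f => op A f (fun=> e)).
    by move=> f; apply: UN.
  by case: (F'P _ FX) => cX; apply; apply: con_eq_Nabla HA cX H.
exists (up X); split=> //; first by move=> x y; right.
move=> psi cpsi Xpsi npsi x y xy; apply: NNPP => nxy.
pose Y (p : A * A) := psi p.1 p.2.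
have upY : up Y = psi.
  by apply: prel_ext => u v; split; [case=> // ?; apply: Xpsi; right | left].
apply: (maxX Y); last by rewrite /P upY.
split=> [[u v] Xuv|YX]; first by apply: Xpsi; left.
by apply: nxy; left; apply: YX.
Qed.

(** A maximal proper [phi] is prime: if neither [a] nor [b] lies below it, both join with it to
    [Nabla], so [Nabla] centralizes itself modulo [phi]. *)
Lemma exists_prime s : is_con s -> ~ (forall x y, s x y) ->
  exists phi, prime_con phi /\ subrel s phi.
Proof.
move=> cs ns; have [phi [cphi sphi nphi maxphi]] := exists_max_con cs ns.
exists phi; split=> //; split=> //; split.
  by move=> E; apply: nphi => x y; apply/E.
move=> a b ca cb abphi; apply: NNPP => nab; apply: nphi => x y.
have C : centralizes a b phi.
  by apply: centralizes_le abphi _ => //; [apply: con_comm|apply: centralizes_comm].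
have joinN c : ~ subrel c phi -> forall u v, join c phi u v.
  move=> nc; apply: NNPP => nj; apply: nc.
  apply: subrel_trans (@subl_join _ _ c phi) _.
  by apply: maxphi => //; [apply: con_join|apply: subr_join].
have aN := joinN a (fun H => nab (or_introl H)).
have bN := joinN b (fun H => nab (or_intror H)).
have := centralizes_join2 ca cb cphi C => C2.
suff: subrel (@Nabla A) phi by apply.
apply: centralizes_Nabla => //.
exact: centralizes_sub C2.
Qed.

(** * Complements, primes and the radical *)

Lemma join_Nabla_of_prime a b :
  (forall phi, prime_con phi -> subrel a phi -> subrel b phi -> False) ->
  forall x y, join a b x y.
Proof.
move=> H; apply: NNPP => /(exists_prime (con_join a b))[phi [pphi abphi]].
by apply: (H phi) => //; apply: subrel_trans abphi; [apply: subl_join|apply: subr_join].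
Qed.

Lemma prime_join_Nabla phi a b : prime_con phi -> subrel a phi -> subrel b phi ->
  ~ (forall x y, join a b x y).
Proof.
move=> [cphi [nphi _]] aphi bphi abN; apply: nphi => x y; split=> // _.
exact: (join_sub cphi aphi bphi).
Qed.

(** A prime above [th] contains [meet e f], hence [e] or [f], hence one of the two joins with
    [rho th]; so it contains their meet. *)
Lemma complemented_join_rho th e : complemented_above th e ->
  complemented_above (rho th) (join e (rho th)).
Proof.
case=> ce [f [cf [ef jef]]]; have cr := con_rho th.
split; first exact: con_join.
exists (join f (rho th)); split; first exact: con_join.
split=> x y; split=> //; last first.
  move=> _; have /jef : Nabla x y by [].
  by apply: join_mono; apply: subl_join.
  by move=> xy; split; apply: subr_join.
case=> exy fxy phi pphi thphi; have cphi := pphi.1.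
have rphi : subrel (rho th) phi by move=> u v; apply.
have [|ephi|fphi] := prime_meet pphi ce cf; first by move=> u v /ef/thphi.
  exact: (join_sub cphi ephi rphi).
exact: (join_sub cphi fphi rphi).
Qed.

(** A prime above [e] and the complement [f'] would contain [e'] too, hence [Nabla]. So [e] and [f']
    join to [Nabla], and [sub_of_join_Nabla] concludes. *)
Lemma complemented_above_sub_prime th e e' : is_con e ->
  subrel th e -> complemented_above th e' ->
  (forall phi, prime_con phi -> subrel th phi -> subrel e phi -> subrel e' phi) ->
  subrel e' e.
Proof.
move=> ce the [ce' [f' [cf' [ef' jef']]]] H.
apply: (sub_of_join_Nabla ce' cf' ce); first by move=> x y /ef'/the.
apply: join_Nabla_of_prime => phi pphi ephi f'phi.
apply: (prime_join_Nabla pphi _ f'phi (a := e')).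
  by apply: H => //; apply: subrel_trans ephi.
by move=> x y; apply/jef'.
Qed.

Lemma complemented_join_rho_inj th e e' :
  complemented_above th e -> complemented_above th e' ->
  join e (rho th) = join e' (rho th) -> e = e'.
Proof.
suff sub g g' : complemented_above th g -> complemented_above th g' ->
    join g (rho th) = join g' (rho th) -> subrel g' g.
  by move=> ae ae' E; apply: subrel_anti; apply: sub.
move=> ag ag' E.
apply: (complemented_above_sub_prime ag.1 (complemented_above_sub ag) ag').
move=> phi pphi thphi gphi.
apply: (subrel_trans (@subl_join _ _ g' (rho th))); rewrite -E.
by apply: join_sub => //; [apply: pphi.1 | move=> x y; apply].
Qed.

(** It suffices to relate one [e] to the finitely many [op A f (fun=> e)], and each such pair uses
    finitely many generators. *)
Lemma exists_compact_join g h : is_con g -> is_con h ->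
  (forall x y, join g h x y) -> exists a b, [/\ compact a, compact b,
    subrel a g, subrel b h & forall x y, join a b x y].
Proof.
move=> cg ch ghN.
suff [s Hs] : exists s, forall x y, join (fg_con g s) (fg_con h s) x y.
  exists (fg_con g s), (fg_con h s).
  by split=> //; (apply: compact_fg_con || apply: fg_con_sub).
have [[e _]|ne] := excluded_middle_informative (exists e : A, True); last first.
  by exists nil => x; case: ne; exists x.
have /skolem[s Hs] : forall f : sym S, exists s,
    join (fg_con g s) (fg_con h s) e (op A f (fun=> e)).
  by move=> f; apply: join_fg_con.
have [l sl] := incl_bound s; exists l.
apply: (con_eq_Nabla (e := e) HA) => [|f]; first exact: con_join.
by apply: join_mono (Hs f); apply: fg_con_mono.
Qed.
End Algebra.

(** * Primes of a quotient and lifting from the radical *)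

Lemma prime_pull (A : algebra S) (th : prel A) (phi : prel (quot_alg th)) :
  models Sigma A -> is_con th -> prime_con phi -> prime_con (pull phi).
Proof.
move=> HA cth pphi; have [cphi [nphi _]] := pphi.
have cp := con_pull cth cphi; split=> //; split.
  move=> E; apply: nphi => X Y; split=> // _.
  by rewrite -(qrepK X) -(qrepK Y); apply/E.
move=> a b ca cb abphi.
have thp := sub_pull cth cphi.
have C : centralizes a b (pull phi).
  apply: (centralizes_le HA ca cb (con_comm a b)) => //.
  exact: centralizes_comm.
(* Joining with [pull phi] brings both congruences above [th], where they come from the quotient. *)
have := centralizes_join2 HA ca cb cp C.
have [ca1 cb1] := (con_join a (pull phi), con_join b (pull phi)).
have tha : subrel th (join a (pull phi)).
  exact: subrel_trans thp (@subr_join _ _ _ _).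
have thb : subrel th (join b (pull phi)).
  exact: subrel_trans thp (@subr_join _ _ _ _).
rewrite -{1}(quot_relK cth ca1 tha) -{1}(quot_relK cth cb1 thb).
move/(pull_centralizes cth)/(prime_centralizes pphi).
case; try exact: con_quot_rel.
  move=> H; left; apply: subrel_trans (@subl_join _ _ a (pull phi)) _.
  by rewrite -(quot_relK cth ca1 tha) => x y; apply: H.
move=> H; right; apply: subrel_trans (@subl_join _ _ b (pull phi)) _.
by rewrite -(quot_relK cth cb1 thb) => x y; apply: H.
Qed.

Lemma prime_quot_rel (A : algebra S) (th phi : prel A) :
  models Sigma A -> is_con th -> prime_con phi -> subrel th phi ->
  prime_con (quot_rel (th := th) phi).
Proof.
move=> HA cth pphi thphi; have [cphi [nphi _]] := pphi.
have cq := con_quot_rel cth cphi thphi; split=> //; split.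
  move=> E; apply: nphi => x y; split=> // _.
  by apply/(quot_relE cth _ _ cphi thphi)/E.
move=> a b ca cb abphi.
have : centralizes a b (quot_rel phi).
  apply: (centralizes_le (models_quot cth HA) ca cb (con_comm a b)) => //.
  exact: centralizes_comm.
move/(pull_centralizes cth); rewrite (quot_relK cth cphi thphi).
have [cpa cpb] := (con_pull cth ca, con_pull cth cb).
case/(prime_centralizes pphi cpa cpb) => H; [left|right].
  by rewrite -(pullK a) => X Y; apply: H.
by rewrite -(pullK b) => X Y; apply: H.
Qed.

(** Compact congruences [a] and [b] below the images of [g] and its complement [h] give
    complementary elements of the reticulation of the quotient. The complemented [E] obtained for
    [a] has the same primes as [g]. *)
Lemma complemented_above_rho (A : algebra S) (th g : prel A) :
  models Sigma A -> is_con th -> ret_preserves_BC (quot_alg th) ->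
  complemented_above (rho th) g ->
  exists e, complemented_above th e /\ join e (rho th) = g.
Proof.
move=> HA cth BC ag; have [cg [h [ch [gh jgh]]]] := ag.
have HQ := models_quot cth HA.
have rg : subrel (rho th) g by move=> x y /gh[].
have rh : subrel (rho th) h by move=> x y /gh[].
have thg := subrel_trans (@sub_rho _ _ th) rg.
have thh := subrel_trans (@sub_rho _ _ th) rh.
have [cqg cqh] := (con_quot_rel cth cg thg, con_quot_rel cth ch thh).
have [|a [b [ka kb aq bh abN]]] := exists_compact_join HQ cqg cqh.
  by move=> X Y; apply/(join_quot_rel cth cg ch thg thh jgh).
have [ca cb] := (ka.1, kb.1).
have [|E [cE rE]] := BC a ka.
  exists b; split=> //; split=> X Y; split.
  - move=> H phi pphi _; apply: H => //.
    apply: subrel_trans (comm_sub_meet ca cb) _ => U V [/aq gUV /bh hUV].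
    have rUV : rho th (qrep U) (qrep V) by apply/gh.
    rewrite -(qrepK U) -(qrepK V); apply: (rUV (pull phi)).
      exact: prime_pull.
    by apply: (sub_pull cth); case: pphi.
  - move=> H phi pphi abphi; apply: H => // U V ->.
    by apply: con_refl; case: pphi.
  (* No prime contains [Nabla] or [join a b], so both radicals are intersections of the empty
     family. *)
  - by move=> _ phi [_ [nphi _]] Nphi; case: nphi => U V; split=> // _; apply: Nphi.
  - by move=> _ phi [cphi [nphi _]] abphi; case: nphi => U V; split=> // _; apply: abphi.
have ae := complemented_pull cth cE; exists (pull E); split=> //.
have ar := complemented_join_rho ae.
have primeE phi : prime_con phi -> subrel th phi ->
    subrel (pull E) phi <-> subrel g phi.
  move=> pphi thphi; have pq := prime_quot_rel HA cth pphi thphi.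
  have cphi := pphi.1.
  have Ea : subrel E (quot_rel phi) <-> subrel a (quot_rel phi).
    split=> H X Y XY.
      have /rE : rho a X Y by apply: sub_rho.
      exact.
    have /rE : rho E X Y by apply: sub_rho.
    exact.
  split=> [Ephi|gphi]; last first.
    apply: (pull_sub cth cphi thphi); apply/Ea.
    by move=> X Y /aq XY; apply: gphi.
  have /Ea aphi : subrel E (quot_rel phi).
    by rewrite -(pullK E) => X Y; apply: Ephi.
  (* If [phi] contained [h], its image in the quotient would contain both [a] and [b], which join to
     [Nabla]. *)
  have [|//|hphi] := prime_meet pphi cg ch.
    by move=> x y /gh; apply.
  case: (prime_join_Nabla pq aphi (b := b)) => // X Y /bh.
  exact: hphi.
have rphi phi : prime_con phi -> subrel th phi -> subrel (rho th) phi.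
  by move=> pphi thphi x y; apply.
have thr := @sub_rho _ _ th.
apply: subrel_anti.
  apply: (complemented_above_sub_prime HA cg rg ar) => phi pphi rp gphi.
  have thp := subrel_trans thr rp.
  apply: join_sub => //; first by case: pphi.
  exact/(primeE _ pphi thp).
apply: (complemented_above_sub_prime HA ar.1 (complemented_above_sub ar) ag).
move=> phi pphi rp jphi; apply/(primeE _ pphi (subrel_trans thr rp)).
exact: subrel_trans (@subl_join _ _ _ _) jphi.
Qed.
End Variety.

Theorem theorem5p4 (S : signature) (Sigma : term S nat * term S nat -> Prop)
  (HCM : forall B : algebra S, models Sigma B -> con_modular B)
  (Hsd : forall B : algebra S, models Sigma B -> semidegenerate_alg B)
  (Hstd : forall B : algebra S, models Sigma B ->
            K_comm_closed B /\ ret_preserves_BC B)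
  (A : algebra S) (HA : models Sigma A) (th : prel A) (Hth : is_con th) :
  CBLP th <-> CBLP (rho th).
Proof.
have cr := con_rho th; have thr := @sub_rho _ _ th.
rewrite (CBLP_above Hth) (CBLP_above cr); split=> lift.
  move=> g ag; have [_ BC] := Hstd _ (models_quot Hth HA).
  have [e [ae <-]] := complemented_above_rho HCM Hsd HA Hth BC ag.
  have [a [ca <-]] := lift e ae; exists a; split=> //.
  by rewrite join_absorb.
move=> e ae; have [a [ca E]] := lift _ (complemented_join_rho ae).
exists a; split=> //.
(* Both [join a th] and [e] are complemented above [th] and agree after joining with [rho th]. *)
apply: (complemented_join_rho_inj HCM Hsd HA _ ae); last by rewrite join_absorb.
exact: (complemented_join HCM Hsd HA).
Qed.
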